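(* Let $\mathbf{D}$ be a semisimple Abelian category equipped with the rank function $\mathrm{length}$. An $(\mathbb{R},\le)$-indexed diagram $F$ in $\mathbf{D}$ is of finite type if and only if it is tame.
   Context: An Abelian category is semisimple if each object is a finite direct sum of simple objects. The length of an object $X$ is $n$ if there is a chain $0\simeq X_0\hookrightarrow X_1\hookrightarrow\dots\hookrightarrow X_n\simeq X$ with all quotients $X_i/X_{i-1}$ simple. An $(\mathbb{R},\le)$-indexed diagram in $\mathbf{D}$ is a functor $F:(\mathbb{R},\le)\to\mathbf{D}$. For a simple object $S$ and an interval $I\subseteq\mathbb{R}$, the diagram $\chi_{I,S}$ is given by $\chi_{I,S}(a)=S$ if $a\in I$ and $0$ otherwise, and $\chi_{I,S}(a\le b)=\mathrm{Id}_S$ if $a,b\in I$ and $0$ otherwise. $F$ has finite type if $F\simeq\bigoplus_{k\in K}\chi_{I_k,S_k}$ for a finite set $K$, intervals $I_k$ and simple objects $S_k$. Put $p_F(u,v)=\mathrm{length}(\mathrm{im}(F(u\le v)))$ for $u\le v$. $F$ is constant on an interval $I\subset\mathbb{R}$ if $p_F(a,a)=p_F(a,b)=p_F(b,b)$ for all $a\le b$ in $I$. A point $a\in\mathbb{R}$ is a regular value if $F$ is constant on some connected neighborhood of $a$, and a critical value otherwise. $F$ is tame if it has finitely many critical values. *)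

(* Defs.v *)
From HB Require Import structures.
From mathcomp Require Import all_boot all_order all_algebra.
From mathcomp Require Import all_classical all_reals all_analysis.
Set Implicit Arguments.
Unset Strict Implicit.
Unset Printing Implicit Defensive.
Import Order.TTheory GRing.Theory Num.Theory.
Import numFieldNormedType.Exports.
Local Open Scope classical_set_scope.
Local Open Scope ring_scope.

Reserved Notation "g \oc f" (at level 40, left associativity).

(* Morphism equality is Leibniz equality; [comp g f] is "g after f". *)
Record preadditive := Preadditive {
  Obj :> Type;
  Hom : Obj -> Obj -> zmodType;
  idm : forall X, Hom X X;
  comp : forall X Y Z, Hom Y Z -> Hom X Y -> Hom X Z;
  comp1m : forall X Y (f : Hom X Y), comp (idm Y) f = f;
  compm1 : forall X Y (f : Hom X Y), comp f (idm X) = f;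
  compA : forall X Y Z W (h : Hom Z W) (g : Hom Y Z) (f : Hom X Y),
    comp h (comp g f) = comp (comp h g) f;
  compDl : forall X Y Z (g g' : Hom Y Z) (f : Hom X Y),
    comp (g + g') f = comp g f + comp g' f;
  compDr : forall X Y Z (g : Hom Y Z) (f f' : Hom X Y),
    comp g (f + f') = comp g f + comp g f' }.

Arguments Hom {p}.
Arguments idm {p} X.
Arguments comp {p X Y Z}.

Notation "g \oc f" := (comp g f) : ring_scope.

Section Preadditive.
Context {C : preadditive}.
Implicit Types X Y Z : C.

Definition is_iso X Y (f : Hom X Y) : Prop :=
  exists g : Hom Y X, g \oc f = idm X /\ f \oc g = idm Y.

Definition isomorphic X Y : Prop := exists f : Hom X Y, is_iso f.

Definition mono X Y (f : Hom X Y) : Prop :=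
  forall Z (g h : Hom Z X), f \oc g = f \oc h -> g = h.

Definition epi X Y (f : Hom X Y) : Prop :=
  forall Z (g h : Hom Y Z), g \oc f = h \oc f -> g = h.

(* Initial and terminal: each hom-group contains 0, so only uniqueness is
   needed. *)
Definition zero_object X : Prop :=
  (forall Y (f : Hom X Y), f = 0) /\ (forall Y (f : Hom Y X), f = 0).

Definition is_kernel X Y (f : Hom X Y) K (k : Hom K X) : Prop :=
  f \oc k = 0 /\
  forall Z (g : Hom Z X), f \oc g = 0 -> exists! h : Hom Z K, k \oc h = g.

Definition is_cokernel X Y (f : Hom X Y) Q (q : Hom Y Q) : Prop :=
  q \oc f = 0 /\
  forall Z (g : Hom Y Z), g \oc f = 0 -> exists! h : Hom Q Z, h \oc q = g.

(* [Y] carries the structure of a biproduct of the finite family [X]; being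
   invariant under isomorphism, this says that [Y] is isomorphic to the
   direct sum of the [X k]. *)
Definition direct_sum (K : finType) (X : K -> C) Y : Prop :=
  exists (i : forall k, Hom (X k) Y) (p : forall k, Hom Y (X k)),
    [/\ forall k, p k \oc i k = idm (X k),
        forall j k, j != k -> p k \oc i j = 0
      & \sum_k (i k \oc p k) = idm Y].

Definition simple X : Prop :=
  ~ zero_object X /\
  forall Y (m : Hom Y X), mono m -> zero_object Y \/ is_iso m.

End Preadditive.

Record abelian := Abelian {
  abelian_preadditive :> preadditive;
  zob : abelian_preadditive;
  zobP : zero_object zob;
  biproductP : forall X Y : abelian_preadditive,
    exists Z, direct_sum (fun b : bool => if b then X else Y) Z;
  ker : forall (X Y : abelian_preadditive) (f : Hom X Y), abelian_preadditive;
  kerm : forall (X Y : abelian_preadditive) (f : Hom X Y), Hom (ker f) X;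
  kermP : forall (X Y : abelian_preadditive) (f : Hom X Y),
    is_kernel f (kerm f);
  coker : forall (X Y : abelian_preadditive) (f : Hom X Y),
    abelian_preadditive;
  cokerm : forall (X Y : abelian_preadditive) (f : Hom X Y), Hom Y (coker f);
  cokermP : forall (X Y : abelian_preadditive) (f : Hom X Y),
    is_cokernel f (cokerm f);
  mono_normal : forall (X Y : abelian_preadditive) (m : Hom X Y), mono m ->
    exists (Z : abelian_preadditive) (f : Hom Y Z), is_kernel f m;
  epi_normal : forall (X Y : abelian_preadditive) (e : Hom X Y), epi e ->
    exists (Z : abelian_preadditive) (f : Hom Z X), is_cokernel f e }.

Arguments zob : clear implicits.

Section Abelian.
Context {D : abelian}.

Definition im (X Y : D) (f : Hom X Y) : D := ker (cokerm f).

(* The chain is indexed by [nat]; only its terms [0, ..., n] matter. *)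
Definition has_length (X : D) (n : nat) : Prop :=
  exists (Y : nat -> D) (i : forall k, Hom (Y k) (Y k.+1)),
    [/\ isomorphic (Y 0%N) (zob D),
        isomorphic (Y n) X
      & forall k, (k < n)%N -> mono (i k) /\ simple (coker (i k))].

(* Value 0 if [X] has no finite length. *)
Definition length (X : D) : nat := xget 0%N [set n | has_length X n].

End Abelian.

Definition semisimple (D : abelian) : Prop :=
  forall X : D, exists (K : finType) (S : K -> D),
    (forall k, simple (S k)) /\ direct_sum S X.

Record diagram (R : realType) (C : preadditive) := Diagram {
  dobj :> R -> C;
  dmap : forall a b : R, a <= b -> Hom (dobj a) (dobj b);
  dmap_id : forall a, dmap (lexx a) = idm (dobj a);
  dmap_comp : forall a b c (ab : a <= b) (bc : b <= c),
    dmap (le_trans ab bc) = dmap bc \oc dmap ab }.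

Arguments dmap {R C} d {a b}.

Section PreadditiveTheory.
Context {C : preadditive}.
Implicit Types X Y Z : C.

Lemma comp0m X Y Z (f : Hom X Y) : (0 : Hom Y Z) \oc f = 0.
Proof. by apply: (addrI ((0 : Hom Y Z) \oc f)); rewrite -compDl !addr0. Qed.

Lemma compm0 X Y Z (g : Hom Y Z) : g \oc (0 : Hom X Y) = 0.
Proof. by apply: (addrI (g \oc (0 : Hom X Y))); rewrite -compDr !addr0. Qed.

Lemma compNm X Y Z (g : Hom Y Z) (f : Hom X Y) : (- g) \oc f = - (g \oc f).
Proof. by apply: (addrI (g \oc f)); rewrite -compDl !subrr comp0m. Qed.

Lemma compmN X Y Z (g : Hom Y Z) (f : Hom X Y) : g \oc (- f) = - (g \oc f).
Proof. by apply: (addrI (g \oc f)); rewrite -compDr !subrr compm0. Qed.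

End PreadditiveTheory.

(* The preadditive category of diagrams, with pointwise addition of natural
   transformations: direct sums of diagrams are taken in it. *)
Section DiagramCategory.
Context {R : realType} {C : preadditive}.
Implicit Types F G H : diagram R C.

Record nattrans F G := Nattrans {
  ntc :> forall a, Hom (F a) (G a);
  ntP : forall a b (ab : a <= b), dmap G ab \oc ntc a = ntc b \oc dmap F ab }.

Lemma nattrans_eq F G (s t : nattrans F G) : (forall a, s a = t a) -> s = t.
Proof.
case: s t => [s sP] [t tP] /= st.
have {}st : s = t by apply: functional_extensionality_dep.
by subst t; congr Nattrans; apply: Prop_irrelevance.
Qed.

HB.instance Definition _ F G := gen_eqMixin (nattrans F G).
HB.instance Definition _ F G := gen_choiceMixin (nattrans F G).

Program Definition nt_zero F G : nattrans F G := @Nattrans F G (fun=> 0) _.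
Next Obligation. by move=> F G a b ab; rewrite comp0m compm0. Qed.

Program Definition nt_opp F G (s : nattrans F G) : nattrans F G :=
  @Nattrans F G (fun a => - s a) _.
Next Obligation. by move=> F G s a b ab; rewrite compNm compmN ntP. Qed.

Program Definition nt_add F G (s t : nattrans F G) : nattrans F G :=
  @Nattrans F G (fun a => s a + t a) _.
Next Obligation. by move=> F G s t a b ab; rewrite compDl compDr !ntP. Qed.

Program Definition nt_id F : nattrans F F := @Nattrans F F (fun a => idm (F a)) _.
Next Obligation. by move=> F a b ab; rewrite comp1m compm1. Qed.

Program Definition nt_comp F G H (t : nattrans G H) (s : nattrans F G) :
  nattrans F H := @Nattrans F H (fun a => t a \oc s a) _.
Next Obligation. by move=> F G H t s a b ab; rewrite compA ntP -!compA ntP. Qed.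

Fact nt_addA F G : associative (@nt_add F G).
Proof. by move=> s t u; apply: nattrans_eq => a /=; rewrite addrA. Qed.
Fact nt_addC F G : commutative (@nt_add F G).
Proof. by move=> s t; apply: nattrans_eq => a /=; rewrite addrC. Qed.
Fact nt_add0 F G : left_id (nt_zero F G) (@nt_add F G).
Proof. by move=> s; apply: nattrans_eq => a /=; rewrite add0r. Qed.
Fact nt_addN F G : left_inverse (nt_zero F G) (@nt_opp F G) (@nt_add F G).
Proof. by move=> s; apply: nattrans_eq => a /=; rewrite addNr. Qed.

HB.instance Definition _ F G := GRing.isZmodule.Build (nattrans F G)
  (@nt_addA F G) (@nt_addC F G) (@nt_add0 F G) (@nt_addN F G).

Program Definition diagram_category : preadditive :=
  @Preadditive (diagram R C) (fun F G => nattrans F G) nt_id nt_comp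
    _ _ _ _ _.
Next Obligation. by move=> *; apply: nattrans_eq => a /=; rewrite comp1m. Qed.
Next Obligation. by move=> *; apply: nattrans_eq => a /=; rewrite compm1. Qed.
Next Obligation. by move=> *; apply: nattrans_eq => a /=; rewrite compA. Qed.
Next Obligation. by move=> *; apply: nattrans_eq => a /=; rewrite compDl. Qed.
Next Obligation. by move=> *; apply: nattrans_eq => a /=; rewrite compDr. Qed.

End DiagramCategory.

Arguments diagram_category : clear implicits.

Section IntervalDiagram.
Context {R : realType} {D : abelian}.
Variables (I : interval R) (S : D).

Definition chi_obj (p : bool) : D := if p then S else zob D.

Definition chi_map (p q : bool) : Hom (chi_obj p) (chi_obj q) :=
  match p, q with
  | true, true => idm S
  | _, _ => 0
  end.

Program Definition chi : diagram R D :=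
  @Diagram R D (fun a => chi_obj (a \in I))
    (fun a b _ => chi_map (a \in I) (b \in I)) _ _.
Next Obligation.
move=> a /=; case: (a \in I) => //=.
by rewrite [RHS](proj1 (zobP D)).
Qed.
Next Obligation.
move=> a b c ab bc /=.
have: (a \in I) && (c \in I) ==> (b \in I).
  apply/implyP => /andP[aI cI].
  by apply: (interval_is_interval aI cI); rewrite ab.
case: (a \in I); case: (b \in I); case: (c \in I) => //= _;
  by rewrite ?comp1m ?comp0m ?compm0.
Qed.

End IntervalDiagram.

Section Tame.
Context {R : realType} {D : abelian}.
Variable F : diagram R D.

Definition finite_type : Prop :=
  exists (K : finType) (I : K -> interval R) (S : K -> D),
    (forall k, simple (S k)) /\
    @direct_sum (diagram_category R D) K (fun k => chi (I k) (S k)) F.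

Definition rank (u v : R) (uv : u <= v) : nat := length (im (dmap F uv)).

Definition constant_on (A : set R) : Prop :=
  forall (a b : R) (ab : a <= b), A a -> A b ->
    rank (lexx a) = rank ab /\ rank ab = rank (lexx b).

Definition regular_value (a : R) : Prop :=
  exists U : set R, [/\ connected U, nbhs a U & constant_on U].

Definition critical_value (a : R) : Prop := ~ regular_value a.

Definition tame : Prop := finite_set [set a | critical_value a].

End Tame.

(* Main.v *)
(** Away from the endpoints of the intervals, a diagram of finite type has
    invertible transition maps, hence constant ranks.

    Conversely, let [F] be tame. In a semisimple category a morphism whose
    source, image and target have the same length is invertible, so by
    completeness of the reals [F] is invertible on each of the finitely many
    cells cut out by the critical values. If [F] is not zero, pick [a] in the
    first nonzero cell and [b >= a] in the last cell with [F (a <= b)] nonzero: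
    some simple subobject [S] of [F a] maps nontrivially to [F b], and Schur's
    lemma provides a retraction of [F b] onto [S]. Both maps extend to all the
    cells from that of [a] to that of [b], which makes [chi I S] a direct
    summand of [F] whose complement has smaller total length over representatives of the
    cells. *)
Require Import Defs.
From mathcomp Require Import all_boot all_order all_algebra.
From mathcomp Require Import all_classical all_reals all_analysis.
(* Restores [Hom], which the vector space library shadows. *)
Import Defs.
Set Implicit Arguments.
Unset Strict Implicit.
Unset Printing Implicit Defensive.
Import Order.TTheory GRing.Theory Num.Theory.
Import numFieldNormedType.Exports.
Local Open Scope classical_set_scope.
Local Open Scope ring_scope.

(** * Isomorphisms, monos, epis and direct sums in preadditive categories *)

Section Preadditive.
Context {C : preadditive}.
Implicit Types X Y Z : C.

Lemma compBl X Y Z (g g' : Hom Y Z) (f : Hom X Y) :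
  (g - g') \oc f = g \oc f - g' \oc f.
Proof. by rewrite compDl compNm. Qed.

Lemma compBr X Y Z (g : Hom Y Z) (f f' : Hom X Y) :
  g \oc (f - f') = g \oc f - g \oc f'.
Proof. by rewrite compDr compmN. Qed.

Lemma comp_suml X Y Z (K : Type) (r : seq K) (P : pred K) (g : K -> Hom Y Z)
    (f : Hom X Y) :
  (\sum_(k <- r | P k) g k) \oc f = \sum_(k <- r | P k) (g k \oc f).
Proof.
by apply: (big_morph (fun g => g \oc f)) => [g1 g2|]; rewrite ?compDl ?comp0m.
Qed.

Lemma comp_sumr X Y Z (K : Type) (r : seq K) (P : pred K) (f : K -> Hom X Y)
    (g : Hom Y Z) :
  g \oc (\sum_(k <- r | P k) f k) = \sum_(k <- r | P k) (g \oc f k).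
Proof. by apply: (big_morph (comp g)) => [f1 f2|]; rewrite ?compDr ?compm0. Qed.

Lemma is_iso_idm X : is_iso (idm X).
Proof. by exists (idm X); rewrite comp1m. Qed.

Lemma is_iso_comp X Y Z (g : Hom Y Z) (f : Hom X Y) :
  is_iso g -> is_iso f -> is_iso (g \oc f).
Proof.
move=> [g' [g'g gg']] [f' [f'f ff']]; exists (f' \oc g'); split.
  by rewrite compA -(compA f') g'g compm1.
by rewrite compA -(compA g) ff' compm1.
Qed.

Lemma is_iso_mono X Y (f : Hom X Y) : is_iso f -> mono f.
Proof.
by move=> [f' [f'f _]] Z g h /(congr1 (comp f')); rewrite !compA f'f !comp1m.
Qed.

Lemma is_iso_epi X Y (f : Hom X Y) : is_iso f -> epi f.
Proof.
move=> [f' [_ ff']] Z g h /(congr1 (fun u => u \oc f')).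
by rewrite -!compA ff' !compm1.
Qed.

Lemma mono_comp X Y Z (g : Hom Y Z) (f : Hom X Y) :
  mono g -> mono f -> mono (g \oc f).
Proof. by move=> gm fm W u v; rewrite -!compA => /gm/fm. Qed.

Lemma mono0P X Y (f : Hom X Y) :
  mono f <-> forall Z (g : Hom Z X), f \oc g = 0 -> g = 0.
Proof.
split=> [fm Z g|f0 Z g h fgh]; first by rewrite -(compm0 _ f) => /fm.
by apply/subr0_eq/f0; rewrite compBr fgh subrr.
Qed.

Lemma epi0P X Y (f : Hom X Y) :
  epi f <-> forall Z (g : Hom Y Z), g \oc f = 0 -> g = 0.
Proof.
split=> [fe Z g|f0 Z g h fgh]; first by rewrite -(comp0m _ f) => /fe.
by apply/subr0_eq/f0; rewrite compBl fgh subrr.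
Qed.

Lemma split_mono X Y (f : Hom X Y) (g : Hom Y X) : g \oc f = idm X -> mono f.
Proof.
move=> gf; apply/mono0P => Z h fh0.
by rewrite -(comp1m h) -gf -compA fh0 compm0.
Qed.

Lemma isomorphic_refl X : isomorphic X X.
Proof. by exists (idm X); apply: is_iso_idm. Qed.

Lemma isomorphic_sym X Y : isomorphic X Y -> isomorphic Y X.
Proof. by move=> [f [g [gf fg]]]; exists g, f. Qed.

Lemma isomorphic_trans X Y Z :
  isomorphic X Y -> isomorphic Y Z -> isomorphic X Z.
Proof. by move=> [f fi] [g gi]; exists (g \oc f); apply: is_iso_comp. Qed.

Lemma zero_objectP X : zero_object X <-> idm X = 0.
Proof.
split=> [[X0 _]|X0]; first exact: X0.
by split=> Y f; [rewrite -(compm1 f)|rewrite -(comp1m f)];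
  rewrite X0 ?compm0 ?comp0m.
Qed.

Lemma zero_object_iso X Y : isomorphic X Y -> zero_object X -> zero_object Y.
Proof.
move=> [f [g [_ fg]]] [X0 _]; apply/zero_objectP.
by rewrite -fg (X0 _ f) comp0m.
Qed.

Lemma simple_iso X Y : isomorphic X Y -> simple X -> simple Y.
Proof.
move=> XY [X0 Xs]; split.
  by move=> /(zero_object_iso (isomorphic_sym XY)).
case: XY => f [f' [f'f ff']] Z m mm.
have f'i : is_iso f' by exists f.
have [|mi] := Xs _ (f' \oc m) (mono_comp (is_iso_mono f'i) mm); first by left.
right; rewrite -(comp1m m) -ff' -compA.
by apply: is_iso_comp => //; exists f'.
Qed.

Lemma is_kernel_mono X Y (f : Hom X Y) K (k : Hom K X) :
  is_kernel f k -> mono k.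
Proof.
move=> [fk kU] Z g h kgh.
have fkh : f \oc (k \oc h) = 0 by rewrite compA fk comp0m.
have [u [_ uU]] := kU _ _ fkh.
by rewrite -(uU g) // -(uU h).
Qed.

Lemma is_cokernel_epi X Y (f : Hom X Y) Q (q : Hom Y Q) :
  is_cokernel f q -> epi q.
Proof.
move=> [qf qU] Z g h gqh.
have hqf : h \oc q \oc f = 0 by rewrite -compA qf compm0.
have [u [_ uU]] := qU _ _ hqf.
by rewrite -(uU g) // -(uU h).
Qed.

Lemma is_cokernel_isomorphic X Y (f : Hom X Y) Q (q : Hom Y Q) Q'
    (q' : Hom Y Q') :
  is_cokernel f q -> is_cokernel f q' -> isomorphic Q Q'.
Proof.
move=> qc qc'; have [[qf qU] [q'f q'U]] := (qc, qc').
have [u [uq _]] := qU _ _ q'f; have [v [vq _]] := q'U _ _ qf.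
exists u, v; split.
  by apply: (is_cokernel_epi qc); rewrite -compA uq vq comp1m.
by apply: (is_cokernel_epi qc'); rewrite -compA vq uq comp1m.
Qed.

(** Puts a split-off summand back: [None] indexes the summand, the indices [Some k] decompose its
    complement [Y]. *)
Lemma direct_sum_option (K : finType) (X : option K -> C) Y Z
    (i : Hom (X None) Z) (p : Hom Z (X None)) (q : Hom Y Z) (r : Hom Z Y) :
  p \oc i = idm _ -> p \oc q = 0 -> r \oc i = 0 -> r \oc q = idm _ ->
  i \oc p + q \oc r = idm _ ->
  direct_sum (fun k => X (Some k)) Y -> direct_sum X Z.
Proof.
move=> pi pq ri rq ipqr [i' [p' [p'i' p'i'0 i'p']]].
exists (fun k => match k with Some k => q \oc i' k | None => i end).
exists (fun k => match k with Some k => p' k \oc r | None => p end).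
split=> [[k|] //|[j|] [k|] //|].
- by rewrite compA -(compA (p' k)) rq compm1.
- by move=> jk; rewrite compA -(compA (p' k)) rq compm1 p'i'0.
- by rewrite compA pq comp0m.
- by rewrite -compA ri compm0.
rewrite (bigD1 None) //= -ipqr; congr (_ + _).
rewrite (reindex_omap Some id) /=; last by case.
under eq_bigl do rewrite eqxx.
transitivity (\sum_k (q \oc (i' k \oc p' k) \oc r)).
  by apply: eq_bigr => k _; rewrite !compA.
by rewrite -comp_suml -comp_sumr i'p' compm1.
Qed.

Lemma is_iso_retract X Y X' Y' (f : Hom X Y) (qX : Hom X' X) (rX : Hom X X')
    (qY : Hom Y' Y) (rY : Hom Y Y') (f' : Hom X' Y') :
  rX \oc qX = idm X' -> rY \oc qY = idm Y' ->
  f \oc qX = qY \oc f' -> f' \oc rX = rY \oc f -> is_iso f -> is_iso f'.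
Proof.
move=> rqX rqY fq fr [g [gf fg]]; exists (rX \oc g \oc qY); split.
  by rewrite -compA -fq compA -(compA rX) gf compm1.
by rewrite !compA fr -(compA rY) fg compm1.
Qed.

(** Says that the map from the direct sum of the [S k], [k \in A], to [Y] is mono, without forming
    that sum. Keeping [A] as a subset of a fixed [K] lets an exchange argument drop one index at a
    time. *)
Definition jointly_mono (K : finType) (S : K -> C) Y (A : {set K})
    (v : forall k, Hom (S k) Y) :=
  forall Z (f : forall k, Hom Z (S k)), \sum_(k in A) (v k \oc f k) = 0 ->
    forall k, k \in A -> f k = 0.

Definition jointly_epi (K : finType) (S : K -> C) Y (A : {set K})
    (v : forall k, Hom (S k) Y) :=
  forall Z (g : Hom Y Z), (forall k, k \in A -> g \oc v k = 0) -> g = 0.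

End Preadditive.

(** * Schur's lemma, the exchange lemma and composition series *)

Section Abelian.
Context {D : abelian}.
Implicit Types X Y Z : D.

Lemma kerm_mono X Y (f : Hom X Y) : mono (kerm f).
Proof. exact: is_kernel_mono (kermP f). Qed.

Lemma kerm_fact X Y Z (f : Hom X Y) (g : Hom Z X) :
  f \oc g = 0 -> exists h, kerm f \oc h = g.
Proof. by move=> fg; have [h [hP _]] := proj2 (kermP f) _ _ fg; exists h. Qed.

(** A mono is a kernel of some [f], and [f] factors through the cokernel [c]; so whatever [c] kills,
    [f] kills too. *)
Lemma mono_fact X Y Q Z (m : Hom X Y) (c : Hom Y Q) (g : Hom Z Y) :
  mono m -> is_cokernel m c -> c \oc g = 0 -> exists h, m \oc h = g.
Proof.
move=> /mono_normal[W [f [fm mU]]] [_ cU] cg.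
have [f' [f'c _]] := cU _ _ fm.
have /mU[h [hP _]] : f \oc g = 0 by rewrite -f'c -compA cg compm0.
by exists h.
Qed.

Lemma mono_epi_iso X Y (f : Hom X Y) : mono f -> epi f -> is_iso f.
Proof.
move=> fm fe; have [W [g [gf gU]]] := mono_normal fm.
have g0 : g = 0 by move/epi0P: fe; apply.
have [h [fh _]] : exists! h, f \oc h = idm Y by apply: gU; rewrite g0 comp0m.
by exists h; split=> //; apply: fm; rewrite compA fh comp1m compm1.
Qed.

(** The kernel of [f] is zero or all of [X]; the latter would give [f = 0]. So [f] is a mono with
    nonzero source into the simple object [Y]. *)
Lemma schur X Y (f : Hom X Y) : simple X -> simple Y -> f <> 0 -> is_iso f.
Proof.
move=> [X0 Xs] [Y0 Ys] f0.
have [K0|[g [_ kg]]] := Xs _ _ (@kerm_mono _ _ f); last first.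
  by case: f0; rewrite -(compm1 f) -kg compA (proj1 (kermP f)) comp0m.
have fm : mono f.
  apply/mono0P => Z g /kerm_fact[h <-].
  by rewrite (proj2 K0 _ h) compm0.
by have [] := Ys _ _ fm.
Qed.

Lemma has_length_iso X Y n : isomorphic X Y -> has_length X n -> has_length Y n.
Proof.
move=> XY [T [i [T0 Tn iP]]]; exists T, i; split=> //.
exact: isomorphic_trans XY.
Qed.

Lemma length_iso X Y : isomorphic X Y -> length X = length Y.
Proof.
move=> XY; rewrite /length; congr xget; apply/funext => n; apply/propext.
by split; apply: has_length_iso => //; apply: isomorphic_sym.
Qed.

Lemma has_length0 X : has_length X 0 -> zero_object X.
Proof.
move=> [T [i [T0 T0X _]]].
apply: (zero_object_iso (isomorphic_trans (isomorphic_sym T0) T0X)).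
exact: zobP.
Qed.

Lemma has_lengthS X n : has_length X n.+1 ->
  exists (Y T : D) (m : Hom Y X) (c : Hom X T),
    [/\ mono m, is_cokernel m c, simple T & has_length Y n].
Proof.
move=> [Y [i [Y0 [e ei] iP]]].
have [im iS] := iP n (ltnSn n).
have [e' [e'e ee']] := ei.
exists (Y n), (coker (i n)), (e \oc i n), (cokerm (i n) \oc e'); split=> //.
- exact: mono_comp (is_iso_mono ei) im.
- have [ci cU] := cokermP (i n); split.
    by rewrite compA -(compA _ e') e'e compm1.
  move=> Z g; rewrite compA => /cU[h [hc hU]]; exists h; split.
    by rewrite compA hc -compA ee' compm1.
  by move=> h' h'P; apply: hU; rewrite -h'P -!compA e'e compm1.
- exists Y, i; split=> //; first exact: isomorphic_refl.
  by move=> k kn; apply/iP/(leq_trans kn).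
Qed.

(** As [c \oc v k0] is invertible, [S k0] is a complement of [Y'] in [Y]. The family [w] is the
    projection of [v] onto [Y'] along [S k0]. *)
Lemma exchange_step (K : finType) (S : K -> D) (A : {set K}) Y Y' T
    (v : forall k, Hom (S k) Y) (m : Hom Y' Y) (c : Hom Y T) k0 :
  mono m -> is_cokernel m c -> k0 \in A -> is_iso (c \oc v k0) ->
  exists w : forall k, Hom (S k) Y',
    (jointly_mono A v <-> jointly_mono (A :\ k0) w) /\
    (jointly_epi A v <-> jointly_epi (A :\ k0) w).
Proof.
move=> mm mc k0A [t [tcv cvt]].
have cm := proj1 mc.
have [pr prP] : exists pr, m \oc pr = idm Y - v k0 \oc t \oc c.
  apply: (mono_fact mm mc).
  by rewrite compBr compm1 !compA cvt comp1m subrr.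
have prv : pr \oc v k0 = 0.
  by apply: mm; rewrite compm0 compA prP compBl comp1m -!compA tcv compm1 subrr.
have prm : pr \oc m = idm Y'.
  by apply: mm; rewrite compA prP compBl comp1m compm1 -compA cm compm0 subr0.
have vE k : v k = m \oc (pr \oc v k) + v k0 \oc (t \oc c \oc v k).
  by rewrite compA prP compBl comp1m !compA subrK.
exists (fun k => pr \oc v k); split; split.
- move=> vm Z f wf0 k; rewrite !inE => /andP[kk0 kA].
  pose s := \sum_(k in A :\ k0) (v k \oc f k).
  (* This coefficient cancels the component of [s] along [S k0]; what remains of the sum is
     [m \oc pr \oc s], which is zero. *)
  pose f0 : Hom Z (S k0) := - (t \oc c \oc s).
  pose f' := eqtype.dfwith f f0.
  have f'E j : j != k0 -> f' j = f j.
    by move=> jk0; rewrite /f' eqtype.dfwith_out // eq_sym.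
  rewrite -f'E //; apply: (vm _ f') => //.
  rewrite (big_setD1 k0) //= /f' eqtype.dfwith_in.
  have -> : \sum_(k in A :\ k0) (v k \oc eqtype.dfwith f f0 k) =
            s.
    by apply: eq_bigr => j; rewrite !inE => /andP[/f'E <-].
  rewrite /f0 compmN addrC -{1}(comp1m s) !compA -compBl -prP -compA comp_sumr.
  by under eq_bigr do rewrite compA; rewrite wf0 compm0.
- move=> wm Z f vf0.
  have fE k : k \in A -> k != k0 -> f k = 0.
    move=> kA kk0; apply: (wm _ f); last by rewrite !inE kk0.
    have : pr \oc \sum_(k in A) (v k \oc f k) = 0 by rewrite vf0 compm0.
    rewrite comp_sumr (big_setD1 k0) //= compA prv comp0m add0r.
    by under eq_bigr do rewrite compA.
  move=> k kA; have [->|] := eqVneq k k0; last exact: fE.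
  move: vf0; rewrite (big_setD1 k0) //= big1 ?addr0; last first.
    by move=> j; rewrite !inE => /andP[jk0 jA]; rewrite fE ?compm0.
  move=> /(congr1 (comp (t \oc c))).
  by rewrite compm0 compA -(compA t) tcv comp1m.
- move=> ve Z g gw; suff gpr : g \oc pr = 0.
    by rewrite -(compm1 g) -prm compA gpr comp0m.
  apply: ve => k kA; rewrite -compA; have [->|kk0] := eqVneq k k0.
    by rewrite prv compm0.
  by apply: gw; rewrite !inE kk0.
- move=> we Z g gv.
  have gm : g \oc m = 0.
    apply: we => k; rewrite !inE => /andP[_ kA].
    by have := gv k kA; rewrite {1}vE compDr !compA gv // !comp0m addr0.
  have [g' [g'c _]] := proj2 mc _ _ gm.
  have := gv k0 k0A; rewrite -g'c -compA => /(congr1 (fun u => u \oc t)).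
  by rewrite comp0m -compA cvt compm1 => ->; rewrite comp0m.
Qed.

(* A form of the Steinitz exchange lemma: comparing a family of simple objects
   over [Y] with a composition series of [Y] yields at once the invariance of
   the length and the equivalence of injectivity and surjectivity in equal
   length. *)
Lemma exchange (K : finType) (S : K -> D) (n : nat) Y (A : {set K})
    (v : forall k, Hom (S k) Y) :
  (forall k, simple (S k)) -> has_length Y n ->
  [/\ jointly_mono A v -> (#|A| <= n)%N,
      jointly_epi A v -> (n <= #|A|)%N
    & #|A| = n -> (jointly_mono A v <-> jointly_epi A v)].
Proof.
move=> Ss; elim: n Y A v => [|n IHn] Y A v.
  move=> /has_length0 Y0; split=> //.
    move=> vm; rewrite leqNgt; apply/negP => /card_gt0P[k kA].
    have /(vm _ (eqtype.dfwith (fun j => 0) (idm (S k)))) : 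
        \sum_(j in A) (v j \oc eqtype.dfwith (fun j => 0) (idm (S k)) j) = 0.
      exact: (proj2 Y0).
    move=> /(_ k kA); rewrite eqtype.dfwith_in => /zero_objectP.
    by case: (Ss k).
  move=> /cards0_eq ->; split=> [_ Z g _|_ Z f _ k]; last by rewrite inE.
  exact: (proj1 Y0).
move=> /has_lengthS[Y' [T [m [c [mm mc Ts Y'n]]]]].
(* Either some [v k] survives in the top factor [T] and is removed together with it, or all of them
   factor through [Y']. *)
have [[k0 k0A /(schur (Ss k0) Ts) cvi]|cv0] :=
    pselect (exists2 k, k \in A & c \oc v k <> 0).
  have [w [vwm vwe]] := exchange_step mm mc k0A cvi.
  have [wm we wme] := IHn _ (A :\ k0) w Y'n.
  have cA : #|A| = #|A :\ k0|.+1 by rewrite (cardsD1 k0) k0A.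
  split=> [/vwm/wm|/vwe/we|]; rewrite cA ?ltnS //.
  by move=> -[/wme]; tauto.
have {}cv0 k : k \in A -> c \oc v k = 0.
  by move=> kA; apply: contrapT => cvk; apply: cv0; exists k.
have ve : ~ jointly_epi A v.
  move=> /(_ _ c cv0) c0; case: Ts => + _; apply; apply/zero_objectP.
  apply: (is_cokernel_epi mc); rewrite c0 compm0.
  by rewrite comp0m.
(* The bound is [n] and not [n.+1]: when [#|A| = n.+1], the family is thus neither jointly mono nor
   jointly epi. *)
have vm0 : jointly_mono A v -> (#|A| <= n)%N.
  have wP k : exists w, k \in A -> m \oc w = v k.
    have [kA|] := boolP (k \in A); last by exists 0.
    by have [w <-] := mono_fact mm mc (cv0 _ kA); exists w.
  have [+ _ _] := IHn _ A (fun k => sval (cid (wP k))) Y'n.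
  move=> wm vm; apply: wm => Z f wf0; apply: vm.
  transitivity (m \oc 0 : Hom Z Y); last exact: compm0.
  rewrite -wf0 comp_sumr; apply: eq_bigr => k kA.
  by rewrite compA (svalP (cid (wP k))).
split=> [/vm0/leqW //| //|An]; split=> [/vm0|//].
by rewrite An ltnn.
Qed.

(** With [e j] the projection onto the summands of index at least [j], the objects [ker (e j)] are
    the partial sums of the first [j] summands and form a composition series. *)
Lemma direct_sum_ord_length n (S : 'I_n -> D) X :
  (forall k, simple (S k)) -> direct_sum S X -> has_length X n.
Proof.
move=> Ss [i [p [pi pij ip]]].
pose e j : Hom X X := \sum_(k < n | (j <= k)%N) (i k \oc p k).
have pe j (k : 'I_n) : (j <= k)%N -> p k \oc e j = p k.
  move=> jk; rewrite comp_sumr (bigD1 k) //= compA pi comp1m big1 ?addr0 //.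
  by move=> l /andP[_ lk]; rewrite compA pij // comp0m.
have pk j (k : 'I_n) : (j <= k)%N -> p k \oc kerm (e j) = 0.
  by move=> jk; rewrite -(pe _ _ jk) -compA (proj1 (kermP _)) compm0.
have ek j : e j.+1 \oc kerm (e j) = 0.
  rewrite comp_suml big1 // => k jk.
  by rewrite -compA pk ?compm0 // ltnW.
pose d j : Hom (ker (e j)) (ker (e j.+1)) := sval (cid (kerm_fact (ek j))).
have dE j : kerm (e j.+1) \oc d j = kerm (e j) by rewrite /d; case: (cid _).
exists (fun j => ker (e j)), d; split.
- exists 0; apply: mono_epi_iso.
    apply/mono0P => Z g _; apply: (@kerm_mono _ _ (e 0%N)); rewrite compm0.
    rewrite -(comp1m (kerm _ \oc g)) -ip; have -> : \sum_k i k \oc p k = e 0%N.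
      exact: eq_bigl.
    by rewrite compA (proj1 (kermP _)) comp0m.
  by apply/epi0P => Z g _; apply: (proj1 (zobP D)).
- exists (kerm (e n)); apply: mono_epi_iso; first exact: kerm_mono.
  have [h hP] : exists h, kerm (e n) \oc h = idm X.
    apply: kerm_fact; rewrite compm1 /e big_pred0 // => k.
    by rewrite leqNgt ltn_ord.
  by apply/epi0P => Z g ge; rewrite -(compm1 g) -hP compA ge comp0m.
- move=> j jn; split.
    apply/mono0P => Z g dg; apply: (@kerm_mono _ _ (e j)).
    by rewrite -dE -compA dg !compm0.
  pose k := Ordinal jn.
  have [t tP] : exists t, kerm (e j.+1) \oc t = i k.
    apply: kerm_fact; rewrite comp_suml big1 // => l jl.
    rewrite -compA pij ?compm0 // -val_eqE /= neq_ltn; by rewrite jl.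
  apply: simple_iso (Ss k); apply: isomorphic_sym.
  suff: is_cokernel (d j) (p k \oc kerm (e j.+1)).
    exact/is_cokernel_isomorphic/cokermP.
  split; first by rewrite -compA dE pk.
  move=> Z g gd; exists (g \oc t); split; last first.
    move=> h <-; rewrite -!compA tP pi compm1 //.
  (* Removing the component along [S k] leads into [ker (e j)], so a map [g] that kills [d j]
     depends only on that component. *)
  have [w wP] : exists w, kerm (e j) \oc w =
      kerm (e j.+1) \oc (idm _ - t \oc (p k \oc kerm (e j.+1))).
    have ejE : e j = i k \oc p k + e j.+1.
      rewrite /e (bigD1 k) //=; congr (_ + _); apply: eq_bigl => l.
      by rewrite -val_eqE /= [RHS]ltn_neqAle eq_sym andbC.
    have ei : e j \oc i k = i k.
      rewrite ejE compDl -compA pi compm1 -tP compA (proj1 (kermP _)) comp0m.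
      exact: addr0.
    apply: kerm_fact; rewrite compBr compm1 (compA _ t) tP compBr compA.
    rewrite ei ejE compDl (proj1 (kermP _)) addr0.
    by rewrite !compA subrr.
  apply/esym/subr0_eq; rewrite -compA -{1}(compm1 g) -compBr.
  suff -> : idm (ker (e j.+1)) - t \oc (p k \oc kerm (e j.+1)) = d j \oc w.
    by rewrite compA gd comp0m.
  by apply: kerm_mono; rewrite -wP compA dE.
Qed.

Lemma direct_sum_has_length (K : finType) (S : K -> D) X :
  (forall k, simple (S k)) -> direct_sum S X -> has_length X #|K|.
Proof.
move=> Ss [i [p [pi pij ip]]].
apply: (@direct_sum_ord_length _ (fun k => S (enum_val k))) => //.
exists (fun k => i (enum_val k)), (fun k => p (enum_val k)); split=> //.
  by move=> j k jk; apply: pij; apply: contra jk => /eqP/enum_val_inj ->.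
by rewrite -ip; symmetry; apply/reindex/onW_bij/enum_val_bij.
Qed.

Lemma direct_sum_mono (K : finType) (S : K -> D) X Y (f : Hom X Y)
    (i : forall k, Hom (S k) X) (p : forall k, Hom X (S k)) :
  (forall k, p k \oc i k = idm (S k)) ->
  (forall j k, j != k -> p k \oc i j = 0) ->
  \sum_k (i k \oc p k) = idm X ->
  mono f <-> jointly_mono [set: K]%SET (fun k => f \oc i k).
Proof.
move=> pi pij ip; split=> [fm Z g fg0 k _|fi].
  have /(congr1 (comp (p k))) : \sum_k (i k \oc g k) = 0.
    apply: fm; rewrite compm0 comp_sumr -[RHS]fg0.
    by apply: eq_big => j; rewrite ?inE // compA.
  rewrite compm0 (bigD1 k) //= compDr compA pi comp1m comp_sumr big1 ?addr0 //.
  by move=> j jk; rewrite compA pij // comp0m.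
apply/mono0P => Z g fg; rewrite -(comp1m g) -ip comp_suml big1 // => k _.
rewrite -compA (fi _ (fun k => p k \oc g)) ?compm0 ?inE //.
under eq_bigr do rewrite compA -(compA f).
rewrite (eq_bigl xpredT) => [|j]; last by rewrite inE.
by rewrite -comp_suml -comp_sumr ip compm1.
Qed.

Lemma direct_sum_epi (K : finType) (S : K -> D) X Y (f : Hom X Y)
    (i : forall k, Hom (S k) X) (p : forall k, Hom X (S k)) :
  \sum_k (i k \oc p k) = idm X ->
  epi f <-> jointly_epi [set: K]%SET (fun k => f \oc i k).
Proof.
move=> ip; split=> [/epi0P fe Z g gf|fi].
  apply: fe; rewrite -(compm1 (g \oc f)) -ip comp_sumr big1 // => k _.
  by rewrite compA -(compA g) gf ?inE // comp0m.
by apply/epi0P => Z g gf; apply: fi => k _; rewrite compA gf comp0m.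
Qed.

Lemma im_iso X Y (f : Hom X Y) : epi f -> isomorphic (im f) Y.
Proof.
move=> fe; exists (kerm (cokerm f)).
apply: mono_epi_iso; first exact: kerm_mono.
have [h hP] : exists h, kerm (cokerm f) \oc h = idm Y.
  apply: kerm_fact; rewrite compm1; move/epi0P: fe; apply.
  exact: (proj1 (cokermP f)).
by apply/epi0P => Z g ge; rewrite -(compm1 g) -hP compA ge comp0m.
Qed.

Lemma length_im_idm X : length (im (idm X)) = length X.
Proof. exact/length_iso/im_iso/is_iso_epi/is_iso_idm. Qed.

Lemma cokerm_eq0 X Y (f : Hom X Y) : cokerm f = 0 -> epi f.
Proof.
move=> c0; apply/epi0P => Z g gf.
by have [h [<- _]] := proj2 (cokermP f) _ _ gf; rewrite c0 compm0.
Qed.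

(** * Length and invertibility in a semisimple category *)

Section Semisimple.
Hypothesis ssD : semisimple D.

(** A decomposition of [X] into simple objects gives existence. Its inclusions are jointly mono and
    jointly epi, so by [exchange] every composition series has as many factors as there are
    summands. *)
Lemma has_lengthP X n : has_length X n <-> length X = n.
Proof.
suff U m k : has_length X m -> has_length X k -> m = k.
  have [K [S [Ss /(direct_sum_has_length Ss) XK]]] := ssD X.
  have XL : has_length X (length X) by apply: (xgetPex 0%N); exists #|K|.
  by split=> [/(U _ _ XL)//|<-].
have [K [S [Ss [i [p [pi pij ip]]]]]] := ssD X.
suff U l : has_length X l -> #|K| = l by move=> /U <- /U <-.
move=> /(exchange [set: K]%SET i Ss)[]; rewrite cardsT.
have iE : (fun k => idm X \oc i k) = i.
  by apply: functional_extensionality_dep => j; rewrite comp1m.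
have im : jointly_mono [set: K]%SET i.
  have /(direct_sum_mono (idm X) pi pij ip) := is_iso_mono (is_iso_idm X).
  by rewrite iE.
have ie : jointly_epi [set: K]%SET i.
  have /(direct_sum_epi (idm X) ip) := is_iso_epi (is_iso_idm X).
  by rewrite iE.
by move=> /(_ im) Kl /(_ ie) lK _; apply/eqP; rewrite eqn_leq Kl.
Qed.

Lemma length_mono X Y (f : Hom X Y) : mono f -> (length X <= length Y)%N.
Proof.
have [K [S [Ss XS]]] := ssD X.
have /has_lengthP -> := direct_sum_has_length Ss XS.
case: XS => i [p [pi pij ip]] /(direct_sum_mono f pi pij ip) fm.
have /has_lengthP Yl := erefl (length Y).
have [/(_ fm)] := exchange [set: K]%SET (fun k => f \oc i k) Ss Yl.
by rewrite cardsT.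
Qed.

Lemma mono_epi_length X Y (f : Hom X Y) :
  length X = length Y -> mono f <-> epi f.
Proof.
have [K [S [Ss XS]]] := ssD X.
have /has_lengthP -> := direct_sum_has_length Ss XS.
case: XS => i [p [pi pij ip]] KY.
have /has_lengthP Yl := esym KY.
have [_ _] := exchange [set: K]%SET (fun k => f \oc i k) Ss Yl.
rewrite cardsT => /(_ erefl) me.
by rewrite (direct_sum_mono f pi pij ip) (direct_sum_epi f ip).
Qed.

(** The inclusion of the image is a mono between objects of equal length, hence epi; so the cokernel
    of [f] vanishes and [f] is epi. Equal lengths again make [f] mono. *)
Lemma rank_iso X Y (f : Hom X Y) :
  length X = length (im f) -> length (im f) = length Y -> is_iso f.
Proof.
move=> Xf fY; have fe : epi f.
  have /(mono_epi_length _ fY)/epi0P ke := @kerm_mono _ _ (cokerm f).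
  by apply/cokerm_eq0/ke; apply: (proj1 (kermP _)).
by apply: mono_epi_iso => //; apply/(mono_epi_length f); rewrite ?Xf.
Qed.

(** Decompose [X] and [Y] into simple objects: a nonzero [f] has a nonzero matrix entry, which is
    invertible by Schur's lemma. *)
Lemma split_simple X Y (f : Hom X Y) : f <> 0 ->
  exists (S : D) (s : Hom S X) (r : Hom Y S),
    simple S /\ r \oc f \oc s = idm S.
Proof.
have [K [S [Ss [i [p [_ _ ip]]]]]] := ssD X.
have [L [T [Ts [j [q [_ _ jq]]]]]] := ssD Y.
move=> f0; have [[[k l] /= /(schur (Ss k) (Ts l)) [v [vf _]]]|N] :=
  pselect (exists kl : K * L, q kl.2 \oc f \oc i kl.1 <> 0).
  exists (S k), (i k), (v \oc q l); split=> //.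
  by rewrite -!compA !compA in vf *.
case: f0; rewrite -(compm1 f) -ip comp_sumr big1 // => k _.
rewrite -(comp1m (f \oc _)) -jq comp_suml big1 // => l _.
suff -> : j l \oc q l \oc (f \oc (i k \oc p k)) =
    j l \oc (q l \oc f \oc i k) \oc p k.
  have -> : q l \oc f \oc i k = 0; last by rewrite compm0 comp0m.
  by apply: contrapT => qfi; apply: N; exists (k, l).
by rewrite !compA.
Qed.

End Semisimple.

Lemma split_complement X Y (i : Hom Y X) (p : Hom X Y) : p \oc i = idm Y ->
  exists (Z : D) (q : Hom Z X) (r : Hom X Z),
    [/\ p \oc q = 0, r \oc i = 0, r \oc q = idm Z
      & i \oc p + q \oc r = idm X].
Proof.
move=> pi; have [r rP] : exists r, kerm p \oc r = idm X - i \oc p.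
  by apply: kerm_fact; rewrite compBr compm1 compA pi comp1m subrr.
have pk : p \oc kerm p = 0 := proj1 (kermP p).
exists (ker p), (kerm p), r; split=> //.
- apply: kerm_mono.
  by rewrite compA rP compBl comp1m -compA pi compm1 subrr compm0.
- apply: kerm_mono.
  by rewrite compA rP compBl comp1m -compA pk compm0 subr0 compm1.
- by rewrite rP addrC subrK.
Qed.

End Abelian.

(** * Invertibility of tame diagrams on cells *)

Section Diagram.
Context {R : realType} {D : abelian}.
Implicit Types (F : diagram R D) (g : R -> nat).

Lemma dmapM F a b c (ab : a <= b) (bc : b <= c) (ac : a <= c) :
  dmap F bc \oc dmap F ab = dmap F ac.
Proof. by rewrite -dmap_comp; congr dmap; apply: bool_irrelevance. Qed.

Lemma dmap1 F a (aa : a <= a) : dmap F aa = idm (F a).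
Proof. by rewrite -dmap_id; congr dmap; apply: bool_irrelevance. Qed.

Lemma ntc_sum F G (K : Type) (r : seq K) (P : pred K)
    (t : K -> @Hom (diagram_category R D) F G) a :
  (\sum_(k <- r | P k) t k : nattrans F G) a =
  \sum_(k <- r | P k) (t k : nattrans F G) a.
Proof. exact: (big_morph (fun t : nattrans F G => t a)). Qed.

Lemma constant_on_iso (ssD : semisimple D) F (A : set R) a b (ab : a <= b) :
  constant_on F A -> A a -> A b -> is_iso (dmap F ab).
Proof.
move=> FA Aa Ab; have [] := FA a b ab Aa Ab; rewrite /rank !dmap_id.
by rewrite !length_im_idm; apply: rank_iso.
Qed.

(** Let [s] be the supremum of the points up to which the transition map from [x] is invertible.
    Constancy of [F] near [s] makes the map to [s] invertible, and carries invertibility beyond [s]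
    if [s < y]. *)
Lemma regular_iso (ssD : semisimple D) F x y (xy : x <= y) :
  (forall z, x <= z <= y -> regular_value F z) -> is_iso (dmap F xy).
Proof.
move=> reg.
pose A := [set t | exists xt : x <= t, t <= y /\ is_iso (dmap F xt)].
have Ax : A x.
  by exists (lexx x); split=> //; rewrite dmap_id; apply: is_iso_idm.
have Aub : ubound A y by move=> t [? []].
have As : has_sup A by split; [exists x|exists y].
set s := sup A.
have xs : x <= s by apply: ub_le_sup => //; exists y.
have sy : s <= y by apply: ge_sup => //; exists x.
have [U [_ /nbhs_ballP[e /= e0 eU] FU]] : regular_value F s.
  by apply: reg; rewrite xs.
have Us : U s by apply: eU; apply: ballxx.
have [t At st] := sup_adherent e0 As; rewrite -/s in st.
have ts : t <= s by apply: ub_le_sup => //; exists y.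
have Ut : U t.
  by apply: eU; rewrite /ball /= ger0_norm ?subr_ge0 // ltrBlDl -ltrBlDr.
have xsi : is_iso (dmap F xs).
  have [xt [_ xti]] := At; rewrite -(dmapM F xt ts).
  by apply: is_iso_comp => //; apply: (constant_on_iso ssD _ FU).
have [sy'|ys] := ltP s y; last first.
  have ys' : y = s by apply/le_anti; rewrite ys sy.
  by move: {sy ys}xy; rewrite ys' => xy; rewrite (bool_irrelevance xy xs).
(* Half the radius keeps [u] inside the ball around [s], and the minimum keeps it below [y]. *)
pose u := Order.min y (s + e / 2).
have su : s < u by rewrite lt_min sy' ltrDl divr_gt0.
have uA : A u.
  exists (le_trans xs (ltW su)); split; first by rewrite ge_min lexx.
  rewrite -(dmapM F xs (ltW su)); apply: is_iso_comp => //.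
  apply: (constant_on_iso ssD _ FU) => //; apply: eU.
  rewrite /ball /= ltr0_norm ?subr_lt0 // opprB ltrBlDl.
  rewrite gt_min; apply/orP; right; rewrite ltrD2l ltr_pdivrMr //.
  by rewrite ltr_pMr // ltr1n.
by have := ub_le_sup (ex_intro _ y Aub) uA; rewrite leNgt su.
Qed.

Definition cellwise_iso F g :=
  forall x y (xy : x <= y), g x = g y -> is_iso (dmap F xy).

Lemma sub_count_lt (T : eqType) (p q : pred T) (s : seq T) c :
  subpred p q -> c \in s -> q c -> ~~ p c -> (count p s < count q s)%N.
Proof.
move=> pq; elim: s => //= d s IHs; rewrite inE => /predU1P[<- qc pc|cs qc pc].
  by rewrite qc (negPf pc) add0n add1n ltnS sub_count.
rewrite -addnS leq_add ?IHs //; case pd : (p d) => //.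
by rewrite (pq _ pd).
Qed.

(* [g] numbers the cells cut out by the critical values, each critical value
   being a cell of its own. *)
Lemma tame_cells (ssD : semisimple D) F : tame F ->
  exists g M, [/\ {homo g : x y / x <= y >-> (x <= y)%N},
    forall x, (g x < M)%N & cellwise_iso F g].
Proof.
move=> /finite_seqP[cs csP].
(* Each critical value raises [g] twice: the weak count on reaching it, the strict count on leaving
   it. *)
pose g x := (count [pred c | (c < x)%R] cs + count [pred c | (c <= x)%R] cs)%N.
exists g, (size cs + size cs).+1%N; split.
- move=> x y xy; apply: leq_add; apply: sub_count => c /= cx.
    exact: lt_le_trans xy.
  exact: le_trans xy.
- by move=> x; rewrite ltnS leq_add ?count_size.
move=> x y xy gxy.
have [exy|xny] := eqVneq x y.
  by subst y; rewrite dmap1; apply: is_iso_idm.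
apply: (regular_iso ssD) => c /andP[xc cy]; apply: contrapT => cc.
have ccs : c \in cs.
  by have : [set a | critical_value F a] c := cc; rewrite csP.
have {xny}xy' : x < y by rewrite lt_neqAle xny.
suff : (g x < g y)%N by rewrite gxy ltnn.
have [cx|xc'] := eqVneq x c.
  subst c; rewrite /g -addSn leq_add //.
    apply: (@sub_count_lt _ _ _ _ x) => //=; last by rewrite ltxx.
    by move=> d /= dx; apply: lt_trans xy'.
  by apply: sub_count => d /= dx; apply: le_trans xy.
rewrite /g -addnS leq_add //.
  by apply: sub_count => d /= dx; apply: lt_trans xy'.
apply: (@sub_count_lt _ _ _ _ c) => //=; last by rewrite -ltNge lt_neqAle xc'.
by move=> d /= dx; apply: le_trans xy.
Qed.


(** * Diagrams of finite type are tame *)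

Definition itv_ends (J : interval R) : seq R :=
  let ends b := if b is BSide _ x then [:: x] else [::] in
  let: Interval l u := J in ends l ++ ends u.

Lemma mem_itv_const (J : interval R) x y : x <= y ->
  (forall c, c \in itv_ends J -> ~~ (x <= c <= y)) -> (x \in J) = (y \in J).
Proof.
case: J => l u xy Hc; rewrite !itv_boundlr; congr (_ && _).
  case: l Hc => [b c|[]] // Hc.
  have {Hc} := Hc c; rewrite mem_head => /(_ isT).
  rewrite negb_and -!ltNge => /orP[cx|yc]; case: b; rewrite !bnd_simp.
  - by rewrite !ltW // (lt_le_trans cx).
  - by rewrite cx (lt_le_trans cx).
  - by rewrite !leNgt yc (le_lt_trans xy yc).
  - by rewrite !ltNge !ltW // (le_lt_trans xy).
case: u Hc => [b c|[]] // Hc.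
have {Hc} := Hc c; rewrite /= mem_cat mem_seq1 eqxx orbT => /(_ isT).
rewrite negb_and -!ltNge => /orP[cx|yc]; case: b; rewrite !bnd_simp.
- by rewrite !ltNge !ltW // (lt_le_trans cx).
- by rewrite !leNgt cx (lt_le_trans cx xy).
- by rewrite yc (le_lt_trans xy yc).
- by rewrite !ltW // (le_lt_trans xy).
Qed.

Lemma seq_separated (a : R) (s : seq R) : a \notin s ->
  exists2 e, 0 < e & forall c, c \in s -> ~ ball a e c.
Proof.
elim: s => [|c s IHs]; first by exists 1.
rewrite inE negb_or => /andP[ac /IHs[e e0 es]].
exists (Order.min e `|a - c|); first by rewrite lt_min e0 normr_gt0 subr_eq0.
move=> d; rewrite inE => /predU1P[->|/es ds].
  by rewrite /ball /= lt_min ltxx andbF.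
by rewrite /ball /= lt_min => /andP[/ds].
Qed.

Lemma rank_iso_eq F a b (ab : a <= b) : is_iso (dmap F ab) ->
  rank F (lexx a) = rank F ab /\ rank F ab = rank F (lexx b).
Proof.
move=> fi; rewrite /rank !dmap_id.
rewrite !length_im_idm (length_iso (im_iso (is_iso_epi fi))); split=> //.
by apply: length_iso; exists (dmap F ab).
Qed.

Lemma chi_mapK (S : D) c d : c = d ->
  chi_map S d c \oc chi_map S c d = idm (chi_obj S c).
Proof.
move=> <-; case: c; first exact: comp1m.
by rewrite /= compm0 [RHS](proj1 (zobP D)).
Qed.

Lemma finite_type_tame F : finite_type F -> tame F.
Proof.
move=> [K [I [S [_ [i [p [_ _ ip]]]]]]].
(* Critical values are confined to the endpoints: a ball that avoids them lies inside or outside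
   each interval. *)
pose s := flatten [seq itv_ends (I k) | k <- enum K].
apply: (@sub_finite_set _ _ [set` s]); last exact: finite_seq.
move=> a /= crit; apply/negP => /negP/seq_separated[e e0 es]; apply: crit.
exists (ball a e); split.
- apply/connected_intervalP; rewrite ball_itv => x y /= xb yb z xyz.
  exact: interval_is_interval xb yb _ xyz.
- exact: nbhsx_ballx.
move=> x y xy ax ay; apply: rank_iso_eq.
have mem k : (x \in I k) = (y \in I k).
  apply: mem_itv_const => // c cI; apply/negP => xcy.
  apply: (es c); first by apply/flatten_mapP; exists k; rewrite ?mem_enum.
  move: ax ay; rewrite ball_itv /= => ax ay.
  exact: interval_is_interval ax ay _ xcy.
have ip1 z :
    \sum_k (i k : nattrans _ _) z \oc (p k : nattrans _ _) z = idm (F z).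
  by rewrite -[RHS]/((nt_id F : nattrans F F) z) -[nt_id F]ip ntc_sum.
(* The inverse is assembled summand by summand, from the structure maps of each [chi] read
   backwards. *)
exists (\sum_k (i k : nattrans _ _) x \oc chi_map (S k) (y \in I k) (x \in I k)
  \oc (p k : nattrans _ _) y); split.
- rewrite comp_suml -ip1; apply: eq_bigr => k _.
  rewrite -!compA -(ntP (p k : nattrans _ _)) (compA (chi_map _ _ _)) /=.
  by rewrite (chi_mapK _ (mem k)) comp1m.
- rewrite comp_sumr -ip1; apply: eq_bigr => k _.
  rewrite !compA (ntP (i k : nattrans _ _)) /= -(compA (ntc (i k) y)).
  by rewrite (chi_mapK _ (esym (mem k))) compm1.
Qed.


(** * Splitting off interval diagrams *)

(* [chi_in] and [chi_out] extend by zero outside of the interval. *)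
Definition chi_in (S X : D) (c : bool) (f : Hom S X) : Hom (chi_obj S c) X :=
  match c with true => f | false => 0 end.

Definition chi_out (S X : D) (c : bool) (f : Hom X S) : Hom X (chi_obj S c) :=
  match c with true => f | false => 0 end.

Lemma chi_outK (S X : D) (c : bool) (f : Hom S X) (h : Hom X S) :
  (c -> h \oc f = idm S) -> chi_out c h \oc chi_in c f = idm (chi_obj S c).
Proof.
case: c => /= [/(_ isT) //|_].
by rewrite [RHS](proj1 (zobP D)) compm0.
Qed.

Lemma chi_from F (I : interval R) (S : D) (f : forall x, Hom S (F x)) :
  (forall x y (xy : x <= y), x \in I -> y \in I -> dmap F xy \oc f x = f y) ->
  (forall x y (xy : x <= y), x \in I -> y \notin I -> dmap F xy \oc f x = 0) ->
  exists t : nattrans (chi I S) F, forall x, t x = chi_in (x \in I) (f x).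
Proof.
move=> f1 f0; unshelve eexists.
  refine (@Nattrans _ _ (chi I S) F (fun x => chi_in (x \in I) (f x)) _).
  move=> x y xy /=; move: (f1 x y xy) (f0 x y xy).
  case: (x \in I); case: (y \in I) => /= fxy fxy0.
  - by rewrite compm1 fxy.
  - by rewrite compm0 fxy0.
  - by rewrite !compm0.
  - by rewrite !compm0.
by [].
Qed.

Lemma chi_to F (I : interval R) (S : D) (f : forall x, Hom (F x) S) :
  (forall x y (xy : x <= y), x \in I -> y \in I -> f y \oc dmap F xy = f x) ->
  (forall x y (xy : x <= y), x \notin I -> y \in I -> f y \oc dmap F xy = 0) ->
  exists t : nattrans F (chi I S), forall x, t x = chi_out (x \in I) (f x).
Proof.
move=> f1 f0; unshelve eexists.
  refine (@Nattrans _ _ F (chi I S) (fun x => chi_out (x \in I) (f x)) _).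
  move=> x y xy /=; move: (f1 x y xy) (f0 x y xy).
  case: (x \in I); case: (y \in I) => /= fxy fxy0.
  - by rewrite comp1m fxy.
  - by rewrite !comp0m.
  - by rewrite comp0m fxy0.
  - by rewrite !comp0m.
by [].
Qed.

Lemma preimage_itv g m n : {homo g : x y / x <= y >-> (x <= y)%N} ->
  exists I : interval R, forall x, (x \in I) = (m <= g x <= n)%N.
Proof.
move=> gh; pose A := [set x | (m <= g x <= n)%N].
have /is_intervalP AE : is_interval A.
  move=> x y /andP[mx _] /andP[_ yn] z /andP[/gh xz /gh zy].
  by rewrite /A /= (leq_trans mx) ?(leq_trans zy).
exists (Rhull A) => x.
have xA : A x = (x \in Rhull A) by rewrite {1}AE.
by apply/idP/idP; rewrite -xA.
Qed.

(* Unlike [leP], this keeps [x <= y] intact in the types of the goal. *)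
Lemma le_or_lt (x y : R) : x <= y \/ y < x.
Proof. by case: leP; [left|right]. Qed.

(** The map [s] is pushed forward beyond [a], pulled back through inverse transition maps in the
    part of the cell of [a] that precedes [a], and replaced by 0 in earlier cells. *)
Lemma extend_from F g (S : D) a (s : Hom S (F a)) :
  {homo g : x y / x <= y >-> (x <= y)%N} -> cellwise_iso F g ->
  exists f : forall x, Hom S (F x),
    (forall x (ax : a <= x), f x = dmap F ax \oc s) /\
    forall x y (xy : x <= y), (g a <= g x)%N -> dmap F xy \oc f x = f y.
Proof.
move=> gh Fg.
have fP x : exists h : Hom S (F x),
    (forall ax : a <= x, h = dmap F ax \oc s) /\
    (forall xa : x <= a, (g a <= g x)%N -> dmap F xa \oc h = s).
  have [ax|xa] := le_or_lt a x.
    exists (dmap F ax \oc s); split=> [ax'|xa _].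
      by rewrite (bool_irrelevance ax ax').
    by rewrite compA (dmapM F _ _ (lexx a)) dmap1 comp1m.
  have [gax|] := leqP (g a) (g x); last first.
    by exists 0; split=> // ax; move: xa; rewrite ltNge ax.
  have gxa : g x = g a by apply/eqP; rewrite eqn_leq gax gh // ltW.
  have [h [_ hP]] := Fg _ _ (ltW xa) gxa.
  exists (h \oc s); split=> [ax|xa' _]; first by have := xa; rewrite ltNge ax.
  by rewrite compA (bool_irrelevance xa' (ltW xa)) hP comp1m.
exists (fun x => sval (cid (fP x))).
split=> [x ax|x y xy gx]; first by case: (cid _) => h [].
case: (cid (fP x)) (cid (fP y)) => [h [hl hg]] [k [kl kg]] /=.
have [ax|/ltW xa] := le_or_lt a x.
  by rewrite hl (kl (le_trans ax xy)) compA (dmapM F ax xy (le_trans ax xy)).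
have [ay|/ltW ya] := le_or_lt a y.
  by rewrite (kl ay) -(hg xa) // compA (dmapM F xa ay xy).
have gya : g y = g a.
  by apply/eqP; rewrite eqn_leq gh // (leq_trans gx) ?gh.
(* Here [x] and [y] both precede [a] in its cell; the two sides are compared in [F a]. *)
apply: (is_iso_mono (Fg _ _ ya gya)).
by rewrite compA (dmapM F xy ya xa) hg // kg // gya.
Qed.

(** Dual to [extend_from]: zero now appears in the cells after that of [b]. *)
Lemma extend_to F g (S : D) b (r : Hom (F b) S) :
  {homo g : x y / x <= y >-> (x <= y)%N} -> cellwise_iso F g ->
  exists f : forall x, Hom (F x) S,
    (forall x (xb : x <= b), f x = r \oc dmap F xb) /\
    forall x y (xy : x <= y), (g y <= g b)%N -> f y \oc dmap F xy = f x.
Proof.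
move=> gh Fg.
have fP x : exists h : Hom (F x) S,
    (forall xb : x <= b, h = r \oc dmap F xb) /\
    (forall bx : b <= x, (g x <= g b)%N -> h \oc dmap F bx = r).
  have [xb|bx] := le_or_lt x b.
    exists (r \oc dmap F xb); split=> [xb'|bx _].
      by rewrite (bool_irrelevance xb xb').
    by rewrite -compA (dmapM F _ _ (lexx b)) dmap1 compm1.
  have [gxb|] := leqP (g x) (g b); last first.
    by exists 0; split=> // xb; move: bx; rewrite ltNge xb.
  have gbx : g b = g x by apply/eqP; rewrite eqn_leq gxb gh // ltW.
  have [h [hP _]] := Fg _ _ (ltW bx) gbx.
  exists (r \oc h); split=> [xb|bx' _]; first by have := bx; rewrite ltNge xb.
  by rewrite -compA (bool_irrelevance bx' (ltW bx)) hP compm1.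
exists (fun x => sval (cid (fP x))).
split=> [x xb|x y xy gy]; first by case: (cid _) => h [].
case: (cid (fP x)) (cid (fP y)) => [h [hl hg]] [k [kl kg]] /=.
have [yb|/ltW b_y] := le_or_lt y b.
  by rewrite (hl (le_trans xy yb)) kl -compA (dmapM F xy yb (le_trans xy yb)).
have [xb|/ltW bx] := le_or_lt x b.
  by rewrite (hl xb) -(kg b_y) // -compA (dmapM F xb b_y xy).
have gbx : g b = g x.
  by apply/eqP; rewrite eqn_leq gh // (leq_trans _ gy) ?gh.
apply: (is_iso_epi (Fg _ _ bx gbx)).
by rewrite -compA (dmapM F bx xy b_y) hg ?gbx // kg.
Qed.

(* The interval is that of a class born in the first nonzero cell and chosen to
   survive the longest, which is what makes [chi I S] a retract. *)
Lemma split_chi (ssD : semisimple D) F g M :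
  {homo g : x y / x <= y >-> (x <= y)%N} -> (forall x, (g x < M)%N) ->
  cellwise_iso F g -> (exists x, ~ zero_object (F x)) ->
  exists (I : interval R) (S : D) (i : nattrans (chi I S) F)
    (p : nattrans F (chi I S)) (a : R),
    [/\ simple S, forall x, p x \oc i x = idm _
      & forall x, g x = g a -> x \in I].
Proof.
move=> gh gM Fg Fn0.
pose P n := `[< exists2 a, g a = n & ~ zero_object (F a) >].
have exP : exists n, P n.
  by case: Fn0 => a Fa; exists (g a); apply/asboolP; exists a.
have [m /asboolP[a ga Fa] mmin] := ex_minnP exP.
pose Q n := `[< exists b (ab : a <= b), g b = n /\ dmap F ab <> 0 >].
have exQ : exists n, Q n.
  exists (g a); apply/asboolP; exists a, (lexx a); split=> //.
  by rewrite dmap1 => /zero_objectP.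
have Qub n : Q n -> (n <= M)%N by move=> /asboolP[b [_ [<- _]]]; apply/ltnW.
have [n /asboolP[b [ab [gb Fab]]] nmax] := ex_maxnP exQ Qub.
have [S [s [r [Ss rs]]]] := split_simple ssD Fab.
have [I IP] := preimage_itv m n gh.
have [f [fa fM]] := extend_from s gh Fg.
have [h [hb hM]] := extend_to r gh Fg.
have [i iE] : exists t : nattrans (chi I S) F,
    forall x, t x = chi_in (x \in I) (f x).
  apply: chi_from => x y xy; rewrite !IP => /andP[mx xn].
    by move=> _; rewrite fM ?ga.
  rewrite negb_and -!ltnNge => /orP[|ny].
    by rewrite ltnNge (leq_trans mx) ?gh.
  (* Past cell [n] the class dies: a nonzero map from [F a] to [F y] would contradict the maximality
     of [n]. *)
  have ay : a <= y.
    rewrite leNgt; apply/negP => /ltW/gh; rewrite leqNgt ga.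
    by rewrite (leq_ltn_trans mx) // (leq_ltn_trans xn).
  rewrite fM ?ga // (fa y ay); have -> : dmap F ay = 0; last by rewrite comp0m.
  apply: contrapT => Fay; have /nmax : Q (g y).
    by apply/asboolP; exists y, ay.
  by rewrite leqNgt ny.
have [p pE] : exists t : nattrans F (chi I S),
    forall x, t x = chi_out (x \in I) (h x).
  apply: chi_to => x y xy; rewrite !IP.
    by move=> _ /andP[_ yn]; rewrite hM ?gb.
  move=> + /andP[my yn]; rewrite negb_and -!ltnNge => /orP[xm|]; last first.
    by rewrite ltnNge (leq_trans _ yn) ?gh.
  (* Before cell [m] the diagram vanishes, by minimality of [m]. *)
  have /zero_objectP Fx : zero_object (F x).
    apply: contrapT => Fx; move: xm; rewrite ltnNge mmin //.
    by apply/asboolP; exists x.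
  by rewrite -(compm1 (_ \oc _)) Fx compm0.
exists I, S, i, p, a; split=> // x; last first.
  move=> gx; rewrite IP gx ga leqnn /=.
  by rewrite -ga -gb gh.
(* At [a] this is the choice of [r] and [s]; compatibility of [f] and [h] with the transition maps
   carries it over the interval. *)
rewrite pE iE; have : x \in I -> h x \oc f x = idm S.
  rewrite IP => /andP[mx xn].
  have fha : h a \oc f a = idm S.
    by rewrite (fa a (lexx a)) (hb a ab) dmap1 comp1m.
  have [ax|/ltW xa] := le_or_lt a x.
    by rewrite -(fM _ _ ax) ?ga // compA hM ?gb.
  by rewrite -(hM x a xa) ?gh // -compA fM ?ga.
exact: chi_outK.
Qed.

(** Complements are chosen pointwise, with transition maps [r y \oc dmap F xy \oc q x]. They compose
    correctly because, by naturality of [i], the cross terms through [G] vanish. *)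
Lemma split_complement_diagram F G (i : nattrans G F) (p : nattrans F G) :
  (forall x, p x \oc i x = idm _) ->
  exists (H : diagram R D) (q : nattrans H F) (r : nattrans F H),
    [/\ forall x, p x \oc q x = 0, forall x, r x \oc i x = 0,
        forall x, r x \oc q x = idm _
      & forall x, i x \oc p x + q x \oc r x = idm _].
Proof.
move=> pi.
have [Z [q [r ZP]]] : exists (Z : R -> D) (q : forall x, Hom (Z x) (F x))
    (r : forall x, Hom (F x) (Z x)), forall x,
    [/\ p x \oc q x = 0, r x \oc i x = 0, r x \oc q x = idm _
      & i x \oc p x + q x \oc r x = idm _].
  pose Z x := cid (split_complement (pi x)).
  pose q x := cid (svalP (Z x)); pose r x := cid (svalP (q x)).
  exists (fun x => sval (Z x)), (fun x => sval (q x)).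
  exists (fun x => sval (r x)) => x.
  exact (svalP (r x)).
have qrE x : q x \oc r x = idm _ - i x \oc p x.
  by have [_ _ _ <-] := ZP x; rewrite addrC addKr.
have rFi x y (xy : x <= y) : r y \oc dmap F xy \oc i x = 0.
  by have [_ ri _ _] := ZP y; rewrite -compA ntP compA ri comp0m.
have pFq x y (xy : x <= y) : p y \oc dmap F xy \oc q x = 0.
  by have [pq _ _ _] := ZP x; rewrite -ntP -compA pq compm0.
pose Hm x y (xy : x <= y) := r y \oc dmap F xy \oc q x.
have Hm1 x : Hm x x (lexx x) = idm _.
  by have [_ _ rq _] := ZP x; rewrite /Hm dmap_id compm1.
have HmM x y z (xy : x <= y) (yz : y <= z) :
    Hm x z (le_trans xy yz) = Hm y z yz \oc Hm x y xy.
  rewrite /Hm !compA -(compA _ (q y)) qrE compBr compm1 compBl compBl.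
  rewrite (compA _ (i y)) rFi !comp0m subr0 -!compA; congr (_ \oc _).
  by rewrite compA dmap_comp.
pose H := @Diagram R D Z Hm Hm1 HmM.
have qP x y (xy : x <= y) : dmap F xy \oc q x = q y \oc dmap H xy.
  rewrite /= /Hm !compA qrE compBl compBl comp1m -(compA _ (p y)).
  by rewrite -(compA (i y)) pFq compm0 subr0.
have rP x y (xy : x <= y) : dmap H xy \oc r x = r y \oc dmap F xy.
  rewrite /= /Hm -(compA _ (q x)) qrE compBr compm1.
  by rewrite (compA _ (i x)) rFi comp0m subr0.
exists H, (@Nattrans _ _ H F q qP), (@Nattrans _ _ F H r rP).
by split=> x /=; have [] := ZP x.
Qed.

(** Induction on [mu F], the total length over one representative per cell. The numbering [g] stays
    fixed, since a complement is a retract of [F] and so inherits invertibility on the cells. *)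
Lemma cellwise_finite_type (ssD : semisimple D) F g M :
  {homo g : x y / x <= y >-> (x <= y)%N} -> (forall x, (g x < M)%N) ->
  cellwise_iso F g -> finite_type F.
Proof.
move=> gh gM.
(* An empty cell gets the representative 0; its term still cannot grow when passing to a summand. *)
pose t k := xget 0 [set x | g x = k].
pose mu F := (\sum_(k < M) length (F (t k)))%N.
have [n] := ubnP (mu F); elim: n F => // n IHn F; rewrite ltnS => Fn Fg.
have [Fn0|F0] := pselect (exists x, ~ zero_object (F x)); last first.
  exists void, (fun v : void => match v with end).
  exists (fun v : void => match v with end).
  split=> [[]|]; exists (fun v : void => match v with end).
  exists (fun v : void => match v with end).
  split=> [[]|[]|]; rewrite big1 => [|[]]; apply: nattrans_eq => x /=.
  suff /zero_objectP -> : zero_object (F x) by [].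
  by apply: contrapT => Fx; apply: F0; exists x.
have [I [S [i [p [a [Ss pi aI]]]]]] := split_chi ssD gh gM Fg Fn0.
have [G [q [r [pq ri rq ipqr]]]] := split_complement_diagram pi.
have Gg : cellwise_iso G g.
  move=> x y xy /(Fg _ _ xy); apply: is_iso_retract (rq x) (rq y) _ _.
    exact: ntP.
  exact: ntP.
have GF x : (length (G x) <= length (F x))%N.
  exact: (length_mono ssD (split_mono (rq x))).
have [K [J [T [Ts GJ]]]] : finite_type G.
  apply: IHn => //; apply: leq_trans Fn.
  rewrite /mu (bigD1 (Ordinal (gM a))) //= [leqRHS](bigD1 (Ordinal (gM a))) //=.
  rewrite -addSn leq_add //; last by apply: leq_sum => k _; apply: GF.
  (* The length drops strictly in the cell of [a], whose representative lies in [I]: otherwise [q]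
     would be epi there, forcing [p = 0] and hence [S] to be zero. *)
  rewrite ltn_neqAle GF andbT; apply/negP => /eqP eGF.
  have taI : t (g a) \in I.
    by apply/aI; apply: (@xgetPex _ 0 [set x | g x = g a]); exists a.
  have := split_mono (rq (t (g a))).
  move=> /(mono_epi_length ssD (q (t (g a))) eGF)/epi0P.
  move=> /(_ _ _ (pq _)) p0; case: Ss => + _; apply; apply/zero_objectP.
  by have := pi (t (g a)); rewrite p0 comp0m /= taI.
exists (option K), (fun o => if o is Some k then J k else I).
exists (fun o => if o is Some k then T k else S); split; first by case.
apply: (@direct_sum_option (diagram_category R D) _ _ G F i p q r) => //;
  exact: nattrans_eq.
Qed.

End Diagram.

Theorem theorem1 (R : realType) (D : abelian) (ssD : semisimple D)
    (F : diagram R D) :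
  finite_type F <-> tame F.
Proof.
split; first exact: finite_type_tame.
move=> /(tame_cells ssD)[g [M [gh gM Fg]]].
exact: cellwise_finite_type gM Fg.
Qed.
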